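(* Let $w\in W_0$ and equip $\Sigma$ with the Weyl chamber orientation $\phi_w$. Let $\lambda\in R^\vee$, $v\in W_0$, and let $\gamma$ be a gallery from $\mathbf{c}_\mathbf{f}$ to $t^\lambda v\,\mathbf{c}_\mathbf{f}$. Let $(\alpha_1,\dots,\alpha_n)$ be a $\phi_w$-positive folding pattern that can be applied to $\gamma$. Consider the path in the undirected moment graph $\mathcal{G}^{un}_{W_0}$ starting in the vertex $v$ with label sequence $(\alpha_1,\dots,\alpha_n)$. Then the end vertex of this path equals the spherical direction $\zeta(z)$ of the end alcove $z\mathbf{c}_\mathbf{f}$ of every gallery $\gamma'$ obtained from $\gamma$ by folding it with the folding pattern $(\alpha_1,\dots,\alpha_n)$.
   Context: Let $\Phi$ be an irreducible crystallographic root system in a Euclidean space $V$ with positive roots $\Phi^+$ and coroot lattice $R^\vee$, Weyl group $W_0$, and for $\alpha\in\Phi^+$ let $r_\alpha\in W_0$ be the reflection in $H_{\alpha,0}$. The affine Weyl group is $W=T\rtimes W_0$ with $T\cong R^\vee$ acting by translations; each $z\in W$ is uniquely $z=t^\mu u$ ($\mu\in R^\vee$, $u\in W_0$) and $\zeta(z):=u$ is its spherical direction. The walls of its Coxeter complex $\Sigma$ are $H_{\alpha,k}=\{y\in V:\langle y,\alpha\rangle=k\}$, $\alpha\in\Phi^+$, $k\in\mathbb{Z}$; $\alpha$ is the class of $H_{\alpha,k}$. Alcoves are closures of components of the complement of all walls; $\mathbf{c}_\mathbf{f}=\{y:0\le\langle y,\alpha\rangle\le1\ \forall\alpha\in\Phi^+\}$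 and $z\mapsto z\mathbf{c}_\mathbf{f}$ is a bijection $W\to$ alcoves. Panels are codimension-one faces of alcoves; panel $p$ lies in a unique wall $H_p$. $\mathcal{C}_u=u\{y:\langle y,\alpha\rangle\ge0\ \forall\alpha\in\Phi^+\}$. Weyl chamber orientation $\phi_w$: the positive side of $H_{\alpha,k}$ is $\{\langle y,\alpha\rangle\ge k\}$ if $\langle\cdot,\alpha\rangle\ge0$ on $\mathcal{C}_w$, else $\{\langle y,\alpha\rangle\le k\}$; $\phi_w(p,\mathbf{c})=+1$ iff alcove $\mathbf{c}$ lies on the positive side of $H_p$. A gallery is $\gamma=(\mathbf{c}_0,p_1,\mathbf{c}_1,\dots,p_n,\mathbf{c}_n)$ with alcoves $\mathbf{c}_i$ and panels $p_i\subseteq\mathbf{c}_{i-1}\cap\mathbf{c}_i$ (repetitions allowed). It is folded at $p_i$ if $\mathbf{c}_{i-1}=\mathbf{c}_i$, positively if moreover $\phi_w(p_i,\mathbf{c}_i)=+1$. Folding $\gamma$ at $p_i$ replaces it by $\gamma^i=(\mathbf{c}_0,p_1,\dots,\mathbf{c}_{i-1},p_i,r_i\mathbf{c}_i,r_ip_{i+1},\dots,r_ip_n,r_i\mathbf{c}_n)$, $r_i$ the affine reflection in $H_{p_i}$. ''$\gamma'$ is obtained from $\gamma$ by folding it with the folding pattern $(\alpha_1,\dots,\alpha_n)$'' means $\gamma'$ arises from $\gamma$ by folding at panels of indices $i_1<\dots<i_n$ such that, in $\gamma'$, the wall containing the $i_k$-th panel has class $\alpha_k$; the pattern is $\phi_w$-positive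 if these folds are all $\phi_w$-positive, and it ''can be applied to $\gamma$'' if such a $\gamma'$ with all these folds $\phi_w$-positive exists. The undirected moment graph $\mathcal{G}^{un}_{W_0}$ has vertex set $W_0$ and, for each $u\in W_0$ and $\alpha\in\Phi^+$, an undirected edge $\{u,r_\alpha u\}$ labeled $\alpha$ (so each vertex has exactly one incident edge with each label, and a path is determined by its start vertex and label sequence). *)

(* Defs.v *)
From HB Require Import structures.
From mathcomp Require Import all_boot all_order all_algebra finmap.
From mathcomp Require Import all_classical all_reals all_analysis.

Set Implicit Arguments.
Unset Strict Implicit.
Unset Printing Implicit Defensive.

Import Order.TTheory GRing.Theory Num.Theory.
Import numFieldNormedType.Exports.

Local Open Scope classical_set_scope.
Local Open Scope ring_scope.

(** * Root systems in the Euclidean space [R^d] *)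

Definition dot (R : realType) (d : nat) (x y : 'rV[R]_d) : R :=
  \sum_(i < d) x 0 i * y 0 i.

Definition coroot (R : realType) (d : nat) (a : 'rV[R]_d) : 'rV[R]_d :=
  (2 / dot a a) *: a.

(* [areflection a k] is the reflection in [wall a k]; for [k = 0] it is the
   linear reflection [r_a]. *)
Definition areflection (R : realType) (d : nat) (a : 'rV[R]_d) (k : int)
    (x : 'rV[R]_d) : 'rV[R]_d :=
  x - (dot x a - k%:~R) *: coroot a.

Definition reflection (R : realType) (d : nat) (a : 'rV[R]_d) :
  'rV[R]_d -> 'rV[R]_d := areflection a 0.

Record crystallographic_root_system (R : realType) (d : nat)
    (Phi : {fset 'rV[R]_d}) : Prop := {
  roots_neq0 : forall a, a \in Phi -> a != 0;
  roots_span : <<Phi>>%VS = fullv;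
  roots_reduced : forall a c, a \in Phi -> c *: a \in Phi -> c = 1 \/ c = -1;
  roots_stable : forall a b, a \in Phi -> b \in Phi -> reflection a b \in Phi;
  roots_integral : forall a b, a \in Phi -> b \in Phi ->
    exists n : int, dot b (coroot a) = n%:~R }.

Definition irreducible_roots (R : realType) (d : nat)
    (Phi : {fset 'rV[R]_d}) : Prop :=
  Phi != fset0 /\
  forall A B : {fset 'rV[R]_d}, Phi = (A `|` B)%fset ->
    (forall a b, a \in A -> b \in B -> dot a b = 0) ->
    A = fset0 \/ B = fset0.

Definition is_positive_roots (R : realType) (d : nat)
    (Phi Pos : {fset 'rV[R]_d}) : Prop :=
  exists rho : 'rV[R]_d,
    (forall a, a \in Phi -> dot rho a != 0) /\
    Pos = [fset a in Phi | 0 < dot rho a]%fset.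

Definition coroot_lattice (R : realType) (d : nat) (Phi : {fset 'rV[R]_d}) :
    set 'rV[R]_d :=
  [set mu | exists n : 'rV[R]_d -> int,
    mu = \sum_(a <- Phi) coroot a *~ n a].

(** * The Weyl group and the affine Weyl group *)

(* Reflections are involutions, so the monoid they generate is a group. *)
Inductive weyl (R : realType) (d : nat) (Phi : {fset 'rV[R]_d}) :
    ('rV[R]_d -> 'rV[R]_d) -> Prop :=
| weyl_id : weyl Phi id
| weyl_refl a u : a \in Phi -> weyl Phi u -> weyl Phi (reflection a \o u).

(* Elements [t^mu u] of the semidirect product of translations and [W_0]. *)
Record aff_elt (R : realType) (d : nat) := AffElt {
  transl : 'rV[R]_d;
  zeta : 'rV[R]_d -> 'rV[R]_d }.

Definition affine_weyl (R : realType) (d : nat) (Phi : {fset 'rV[R]_d})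
    (z : aff_elt R d) : Prop :=
  coroot_lattice Phi (transl z) /\ weyl Phi (zeta z).

Definition aff_act (R : realType) (d : nat) (z : aff_elt R d)
    (x : 'rV[R]_d) : 'rV[R]_d := zeta z x + transl z.

(** * Walls, alcoves and panels of the Coxeter complex *)

Definition wall (R : realType) (d : nat) (a : 'rV[R]_d) (k : int) :
  set 'rV[R]_d := [set y | dot y a = k%:~R].

Definition walls_complement (R : realType) (d : nat) (Pos : {fset 'rV[R]_d}) :
    set 'rV[R]_d :=
  [set y | forall a (k : int), a \in Pos -> ~ wall a k y].

Definition is_alcove (R : realType) (d : nat) (Pos : {fset 'rV[R]_d})
    (c : set 'rV[R]_d) : Prop :=
  exists2 x, walls_complement Pos x &
    c = closure (connected_component (walls_complement Pos) x).

Definition fund_alcove (R : realType) (d : nat) (Pos : {fset 'rV[R]_d}) :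
    set 'rV[R]_d :=
  [set y | forall a, a \in Pos -> 0 <= dot y a /\ dot y a <= 1].

(* The affine hull of [F] has dimension [k]: it is [x + <<s - x>>]. *)
Definition affine_dim (R : realType) (d : nat) (F : set 'rV[R]_d)
    (k : nat) : Prop :=
  exists (x : 'rV[R]_d) (s : seq 'rV[R]_d),
    let U := <<[seq y - x | y <- s]>>%VS in
    [/\ F x, (forall y, y \in s -> F y), (forall y, F y -> y - x \in U) &
        \dim U = k].

(* Faces of a polytope: its intersections with supporting hyperplanes. *)
Definition is_face (R : realType) (d : nat) (c F : set 'rV[R]_d) : Prop :=
  exists (f : 'rV[R]_d) (m : R),
    (forall y, c y -> dot y f <= m) /\ F = c `&` [set y | dot y f = m].

Definition is_panel (R : realType) (d : nat) (Pos : {fset 'rV[R]_d})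
    (p : set 'rV[R]_d) : Prop :=
  exists c, [/\ is_alcove Pos c, is_face c p &
    exists2 k, affine_dim p k & k.+1 = d].

(* [wall a k] is the wall [H_p]; in particular [a] is its class. *)
Definition wall_of (R : realType) (d : nat) (Pos : {fset 'rV[R]_d})
    (p : set 'rV[R]_d) (a : 'rV[R]_d) (k : int) : Prop :=
  a \in Pos /\ p `<=` wall a k.

(** * Weyl chamber orientations *)

Definition weyl_chamber (R : realType) (d : nat) (Pos : {fset 'rV[R]_d})
    (u : 'rV[R]_d -> 'rV[R]_d) : set 'rV[R]_d :=
  u @` [set y | forall a, a \in Pos -> 0 <= dot y a].

Definition positive_side (R : realType) (d : nat) (Pos : {fset 'rV[R]_d})
    (w : 'rV[R]_d -> 'rV[R]_d) (a : 'rV[R]_d) (k : int) : set 'rV[R]_d :=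
  if `[< forall y, weyl_chamber Pos w y -> 0 <= dot y a >]
  then [set y | k%:~R <= dot y a]
  else [set y | dot y a <= k%:~R].

Definition orientation (R : realType) (d : nat) (Pos : {fset 'rV[R]_d})
    (w : 'rV[R]_d -> 'rV[R]_d) (p c : set 'rV[R]_d) : int :=
  if `[< exists a k, wall_of Pos p a k /\ c `<=` positive_side Pos w a k >]
  then 1 else -1.

(** * Galleries and foldings *)

(* A gallery [(c_0, p_1, c_1, ..., p_n, c_n)] is stored as the two sequences
   [c_0 ... c_n] and [p_1 ... p_n]; panel indices start at 1. *)
Record gallery (V : Type) := Gallery {
  alcoves : seq (set V);
  panels : seq (set V) }.

Definition alcove_at (V : Type) (g : gallery V) (i : nat) : set V :=
  nth set0 (alcoves g) i.

Definition panel_at (V : Type) (g : gallery V) (i : nat) : set V :=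
  nth set0 (panels g) i.-1.

Definition panel_index (V : Type) (g : gallery V) (i : nat) : Prop :=
  (0 < i <= size (panels g))%N.

Definition end_alcove (V : Type) (g : gallery V) : set V :=
  alcove_at g (size (panels g)).

Definition is_gallery (R : realType) (d : nat) (Pos : {fset 'rV[R]_d})
    (g : gallery 'rV[R]_d) : Prop :=
  [/\ size (alcoves g) = (size (panels g)).+1,
      (forall i, (i <= size (panels g))%N -> is_alcove Pos (alcove_at g i)) &
      (forall i, panel_index g i ->
         is_panel Pos (panel_at g i) /\
         panel_at g i `<=` alcove_at g i.-1 `&` alcove_at g i)].

Definition folded_at (V : Type) (g : gallery V) (i : nat) : Prop :=
  panel_index g i /\ alcove_at g i.-1 = alcove_at g i.

Definition positively_folded_at (R : realType) (d : nat)
    (Pos : {fset 'rV[R]_d}) (w : 'rV[R]_d -> 'rV[R]_d)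
    (g : gallery 'rV[R]_d) (i : nat) : Prop :=
  folded_at g i /\ orientation Pos w (panel_at g i) (alcove_at g i) = 1.

(* Keeps [c_0, p_1, ..., c_(i-1), p_i] and applies [r] to everything after. *)
Definition map_tail (V : Type) (r : V -> V) (i : nat) (g : gallery V) :
    gallery V :=
  let img (A : set V) : set V := r @` A in
  Gallery (take i (alcoves g) ++ map img (drop i (alcoves g)))
          (take i (panels g) ++ map img (drop i (panels g))).

Definition folding (R : realType) (d : nat) (Pos : {fset 'rV[R]_d})
    (g : gallery 'rV[R]_d) (i : nat) (g' : gallery 'rV[R]_d) : Prop :=
  panel_index g i /\
  exists a k, wall_of Pos (panel_at g i) a k /\
    g' = map_tail (areflection a k) i g.

Fixpoint foldings (R : realType) (d : nat) (Pos : {fset 'rV[R]_d})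
    (g : gallery 'rV[R]_d) (I : seq nat) (g' : gallery 'rV[R]_d) : Prop :=
  if I is i :: I' then
    exists g1, folding Pos g i g1 /\ foldings Pos g1 I' g'
  else g' = g.

Definition folded_by_at (R : realType) (d : nat) (Pos : {fset 'rV[R]_d})
    (alphas : seq 'rV[R]_d) (I : seq nat) (g g' : gallery 'rV[R]_d) : Prop :=
  [/\ size I = size alphas, sorted ltn I, foldings Pos g I g' &
      forall k, (k < size alphas)%N ->
        exists m, wall_of Pos (panel_at g' (nth 0%N I k)) (nth 0 alphas k) m].

Definition obtained_by_pattern (R : realType) (d : nat)
    (Pos : {fset 'rV[R]_d}) (alphas : seq 'rV[R]_d)
    (g g' : gallery 'rV[R]_d) : Prop :=
  exists I, folded_by_at Pos alphas I g g'.

Definition positive_pattern_applies (R : realType) (d : nat)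
    (Pos : {fset 'rV[R]_d}) (w : 'rV[R]_d -> 'rV[R]_d)
    (alphas : seq 'rV[R]_d) (g : gallery 'rV[R]_d) : Prop :=
  exists g' I, folded_by_at Pos alphas I g g' /\
    forall i, i \in I -> positively_folded_at Pos w g' i.

(** * The undirected moment graph *)

Definition moment_edge (R : realType) (d : nat) (Phi Pos : {fset 'rV[R]_d})
    (a : 'rV[R]_d) (u u' : 'rV[R]_d -> 'rV[R]_d) : Prop :=
  exists x, [/\ weyl Phi x, a \in Pos &
    (u = x /\ u' = reflection a \o x) \/ (u = reflection a \o x /\ u' = x)].

(* [us] lists the vertices after the start vertex [u]. *)
Fixpoint moment_path (R : realType) (d : nat) (Phi Pos : {fset 'rV[R]_d})
    (u : 'rV[R]_d -> 'rV[R]_d) (labels : seq 'rV[R]_d)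
    (us : seq ('rV[R]_d -> 'rV[R]_d)) : Prop :=
  match labels, us with
  | [::], [::] => True
  | a :: labels', u' :: us' =>
      moment_edge Phi Pos a u u' /\ moment_path Phi Pos u' labels' us'
  | _, _ => False
  end.

(* Main.v *)
(** A folding replaces the end alcove by its image under the affine reflection in
    the wall of the fold, so its spherical direction is multiplied on the left by
    the linear reflection [r_a], [a] being the class of that wall; this is also
    what crossing the edge labelled [a] of the moment graph does. Later folds leave
    the panel of an earlier one in place, and a panel determines the class of its
    wall because it has codimension one.

    The spherical direction of the end alcove is well defined because the affine
    Weyl group acts freely on alcoves. To see this, fix a point [x] inside the
    fundamental alcove and call a reflection simple if its wall is the only one
    separating [x] from its image. Every reflection is a product of simple ones, by
    induction on the distance from [x] to its wall: if [r] is not simple, some wall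
    [K] closer to [x] satisfies [r = r_K r' r_K] with the wall of [r'] closer too.
    If a nonempty product of simple reflections keeps [x] in its alcove, then the
    wall of its first factor is crossed a second time, and deleting both crossings
    gives a shorter product with the same value. *)
Require Import Defs.
From HB Require Import structures.
From mathcomp Require Import all_boot all_order all_algebra finmap.
From mathcomp Require Import all_classical all_reals all_analysis.
From mathcomp Require Import ring lra zify.

Set Implicit Arguments.
Unset Strict Implicit.
Unset Printing Implicit Defensive.

Import Order.TTheory GRing.Theory Num.Theory.
Import numFieldNormedType.Exports.

Local Open Scope classical_set_scope.
Local Open Scope ring_scope.

(** * Scalar products and reflections *)

Section Dot.
Variables (R : realType) (d : nat).
Implicit Types x y a b : 'rV[R]_d.

Lemma dotC x y : dot x y = dot y x.
Proof. by apply: eq_bigr => i _; rewrite mulrC. Qed.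

Lemma dotDl x y a : dot (x + y) a = dot x a + dot y a.
Proof. by rewrite -big_split; apply: eq_bigr => i _; rewrite mxE mulrDl. Qed.

Lemma dotZl c x a : dot (c *: x) a = c * dot x a.
Proof. by rewrite mulr_sumr; apply: eq_bigr => i _; rewrite mxE mulrA. Qed.

Lemma dotNl x a : dot (- x) a = - dot x a.
Proof. by rewrite -scaleN1r dotZl mulN1r. Qed.

Lemma dotBl x y a : dot (x - y) a = dot x a - dot y a.
Proof. by rewrite dotDl dotNl. Qed.

Lemma dotDr x y a : dot a (x + y) = dot a x + dot a y.
Proof. by rewrite dotC dotDl !(dotC a). Qed.

Lemma dotZr c x a : dot a (c *: x) = c * dot a x.
Proof. by rewrite dotC dotZl (dotC a). Qed.

Lemma dotNr x a : dot a (- x) = - dot a x.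
Proof. by rewrite dotC dotNl (dotC a). Qed.

Definition dotE := (dotDl, dotNl, dotZl, dotDr, dotNr, dotZr).

Lemma dot0l a : dot 0 a = 0.
Proof. by rewrite -(scale0r a) dotZl mul0r. Qed.

Lemma dot_suml I (r : seq I) (F : I -> 'rV[R]_d) a :
  dot (\sum_(i <- r) F i) a = \sum_(i <- r) dot (F i) a.
Proof.
elim: r => [|i r IH]; first by rewrite !big_nil dot0l.
by rewrite !big_cons dotDl IH.
Qed.

Lemma dot_ge0 a : 0 <= dot a a.
Proof. by apply: sumr_ge0 => i _; rewrite -expr2 sqr_ge0. Qed.

Lemma dot_eq0 a : (dot a a == 0) = (a == 0).
Proof.
apply/eqP/eqP => [|->]; last exact: dot0l.
move=> /eqP; rewrite psumr_eq0; last by move=> i _; rewrite -expr2 sqr_ge0.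
move=> /allP h; apply/rowP => i; rewrite mxE.
by have := h i (mem_index_enum _); rewrite -expr2 sqrf_eq0 => /eqP.
Qed.

Lemma dot_gt0 a : a != 0 -> 0 < dot a a.
Proof. by move=> a0; rewrite lt_def dot_eq0 a0 dot_ge0. Qed.

(** The equality case of Cauchy-Schwarz: the difference of the two sides has squared norm [dot a a]
    times the Gram determinant of [a] and [b]. *)
Lemma dot_CS_collinear a b :
  dot a a * dot b b <= dot a b ^+ 2 -> dot a a *: b = dot a b *: a.
Proof.
move=> h; have [->|a0] := eqVneq a 0; first by rewrite dot0l scale0r scaler0.
have p0 := dot_gt0 a0.
apply/eqP; rewrite -subr_eq0 -dot_eq0 eq_le dot_ge0 andbT.
rewrite [leLHS](_ : _ = dot a a * (dot a a * dot b b - dot a b ^+ 2)); last first.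
  by rewrite !dotE (dotC b a); ring.
by rewrite pmulr_rle0 // subr_le0.
Qed.

Lemma areflectionE a k y :
  areflection a k y = y - ((dot y a - k%:~R) * (2 / dot a a)) *: a.
Proof. by rewrite /areflection /coroot scalerA. Qed.

Lemma dot_coroot b a : dot b (coroot a) = 2 * dot b a / dot a a.
Proof. by rewrite dotZr mulrAC. Qed.

Lemma areflection_invol a k : a != 0 -> involutive (areflection a k).
Proof.
move=> /dot_gt0/lt0r_neq0 a0 y; rewrite !areflectionE -addrA -opprD -scalerDl.
rewrite -[RHS]subr0; congr (_ - _); apply/eqP; rewrite scaler_eq0.
apply/orP; left; rewrite !dotE.
by apply/eqP; field.
Qed.

Lemma areflection_dot a y b (k : int) : dot (areflection a k y) b =
  dot y b - (dot y a - k%:~R) * dot b (coroot a).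
Proof. by rewrite /areflection dotBl dotZl (dotC b). Qed.

Lemma reflectionE a y : reflection a y = y - dot y a *: coroot a.
Proof. by rewrite /reflection /areflection subr0. Qed.

Lemma dot_reflectionC a y b : dot (reflection a y) b = dot y (reflection a b).
Proof. by rewrite !reflectionE /coroot !dotE (dotC b a); ring. Qed.

Lemma reflection_dot a y b : a != 0 -> dot (reflection a y) (reflection a b) = dot y b.
Proof. by move=> a0; rewrite dot_reflectionC /reflection areflection_invol. Qed.

Lemma reflectionZ a c x : reflection a (c *: x) = c *: reflection a x.
Proof. by rewrite !reflectionE dotZl scalerBr -scalerA. Qed.

Lemma areflection_affine a k y x :
  areflection a k (y + x) = reflection a y + areflection a k x.
Proof.
rewrite reflectionE /areflection dotDl -(addrA (dot y a)) scalerDl opprD.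
by rewrite addrACA.
Qed.

Lemma coroot_reflection a b : a != 0 ->
  coroot (reflection a b) = reflection a (coroot b).
Proof. by move=> a0; rewrite /coroot reflection_dot // reflectionZ. Qed.

Lemma reflection_self a : a != 0 -> reflection a a = - a.
Proof.
move=> /dot_gt0/lt0r_neq0 a0; rewrite reflectionE /coroot scalerA.
have -> : dot a a * (2 / dot a a) = 2 by field.
by rewrite scaler_nat mulr2n opprD addNKr.
Qed.

Lemma coroot_opp a : coroot (- a) = - coroot a.
Proof. by rewrite /coroot dotNl dotNr opprK scalerN. Qed.

Lemma areflection_opp a k : areflection (- a) (- k) = areflection a k.
Proof.
apply/funext => y.
by rewrite /areflection coroot_opp dotNr mulrNz -opprD scaleNr
  scalerN opprK.
Qed.
End Dot.

(** * Products of affine reflections *)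

Lemma ltn_count (T : eqType) (p q : pred T) (s : seq T) z :
  subpred p q -> z \in s -> q z -> ~~ p z -> (count p s < count q s)%N.
Proof.
move=> pq + qz npz; elim: s => [//|w s IH] /=; rewrite inE => /predU1P[<-|/IH h].
  by rewrite qz (negPf npz) add1n ltnS sub_count.
have : (p w <= q w)%N by case: (p w) (pq w) => // ->.
by lia.
Qed.

Section AffineRoots.
Variables (R : realType) (d : nat).
Notation V := 'rV[R]_d.
Variable Phi : {fset V}.
Hypothesis hPhi : crystallographic_root_system Phi.
Notation aroot := (V * int)%type.
Implicit Types (al be ga : aroot) (x y : V) (s : seq aroot).

Definition aval al y : R := dot y al.1 - al.2%:~R.

Definition arefl al : V -> V := areflection al.1 al.2.

Lemma arefl_invol al : al.1 \in Phi -> involutive (arefl al).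
Proof. by move=> /(roots_neq0 hPhi); exact: areflection_invol. Qed.

Lemma roots_opp a : a \in Phi -> - a \in Phi.
Proof.
move=> ha; rewrite -reflection_self; last exact: (roots_neq0 hPhi).
exact: (roots_stable hPhi).
Qed.

Definition aopp al : aroot := (- al.1, - al.2).

Lemma aval_opp al y : aval (aopp al) y = - aval al y.
Proof. by rewrite /aval /= dotNr mulrNz opprD. Qed.

Lemma arefl_opp al : arefl (aopp al) = arefl al.
Proof. exact: areflection_opp. Qed.

Lemma aval_arefl al be y :
  aval al (arefl be y) = aval al y - aval be y * dot al.1 (coroot be.1).
Proof. by rewrite /aval /arefl areflection_dot addrAC. Qed.

(** Integrality of [dot al.1 (coroot be.1)] makes the level of the reflected wall an integer. The
    last clause is the conjugation relation, written without inverses. *)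
Lemma arefl_pullback al be : al.1 \in Phi -> be.1 \in Phi ->
  exists ga, [/\ ga.1 = reflection be.1 al.1,
    forall y, aval ga y = aval al (arefl be y) &
    arefl be \o arefl ga = arefl al \o arefl be].
Proof.
move=> ha hb; have [n hn] := roots_integral hPhi hb ha.
exists (reflection be.1 al.1, al.2 - be.2 * n).
have hv y : aval (reflection be.1 al.1, al.2 - be.2 * n) y = aval al (arefl be y).
  rewrite aval_arefl hn /aval /= -dot_reflectionC reflectionE dotBl dotZl.
  by rewrite (dotC (coroot _)) hn rmorphB rmorphM /=; ring.
split=> //; apply/funext => y /=.
rewrite {1 3}/arefl [in RHS]/areflection -/(aval al _) -hv.
rewrite {1}[arefl _ y]/areflection /= -/(aval (_, _) y).
rewrite coroot_reflection; last exact: (roots_neq0 hPhi).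
rewrite -scaleNr -reflectionZ addrC areflection_affine.
rewrite /reflection areflection_invol; last exact: (roots_neq0 hPhi).
by rewrite scaleNr addrC.
Qed.

Definition word s : V -> V := foldr (fun al f => arefl al \o f) id s.

Lemma word_cat s t : word (s ++ t) = word s \o word t.
Proof. by elim: s => //= al s ->. Qed.

Lemma word_pullback s al : {in s, forall be, be.1 \in Phi} -> al.1 \in Phi ->
  exists ga, [/\ ga.1 \in Phi, forall y, aval ga y = aval al (word s y) &
    word s \o arefl ga = arefl al \o word s].
Proof.
elim: s al => [|be s IH] al hs ha; first by exists al.
have hb : be.1 \in Phi by apply: hs; rewrite mem_head.
have [ga0 [e0 v0 c0]] := arefl_pullback ha hb.
have h0 : ga0.1 \in Phi by rewrite e0; apply: (roots_stable hPhi).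
have [|ga [hg v1 c1]] := IH ga0 _ h0.
  by move=> c hc; apply: hs; rewrite inE hc orbT.
exists ga; split=> //; first by move=> y; rewrite v1 v0.
by rewrite /= -compA c1 compA c0.
Qed.

Lemma word_rev_cancel s : {in s, forall be, be.1 \in Phi} ->
  cancel (word s) (word (rev s)).
Proof.
elim: s => [|be s IH] hs y //=.
rewrite rev_cons -cats1 word_cat /= arefl_invol; last by apply: hs; rewrite mem_head.
by apply: IH => c hc; apply: hs; rewrite inE hc orbT.
Qed.

(** * Simple reflections seen from a regular base point *)

Section BasePoint.
Variable x : V.
Hypothesis x_regular : forall al, al.1 \in Phi -> aval al x != 0.

(** The product is negative exactly when the wall of [be] strictly separates [x] from its mirror
    image. Reflections are compared instead of pairs, because [be] and [aopp be] share a wall. *)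
Definition simple_at al : Prop := al.1 \in Phi /\
  forall be, be.1 \in Phi -> aval be x * aval be (arefl al x) < 0 ->
  arefl be = arefl al.

Lemma word_regular s al : {in s, forall be, be.1 \in Phi} -> al.1 \in Phi ->
  aval al (word s x) != 0.
Proof.
by move=> hs ha; have [ga [hg v _]] := word_pullback hs ha; rewrite -v x_regular.
Qed.

Definition wall_dist2 al : R := aval al x ^+ 2 / dot al.1 al.1.

Lemma wall_dist2_opp al : wall_dist2 (aopp al) = wall_dist2 al.
Proof. by rewrite /wall_dist2 aval_opp sqrrN /= dotNl dotNr opprK. Qed.

Lemma finitely_many_close_walls (D : R) :
  exists L : seq aroot, forall al, al.1 \in Phi -> wall_dist2 al <= D -> al \in L.
Proof.
(* Summing over [Phi] bounds [|k|] for all roots at once. The part [1 + D * dot a a] comes from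
   [t <= 1 + t ^+ 2], which avoids square roots. *)
pose B := \sum_(a <- Phi) (`|dot x a| + 1 + D * dot a a).
pose M := Num.bound `|B|.
pose ks := [seq i%:Z - M%:Z | i <- iota 0 (M + M).+1].
pose L := [seq (a, k) | a <- (Phi : seq V), k <- ks].
exists L.
move=> [a k] /= ha hD; apply: allpairs_f => //.
have p0 := dot_gt0 (roots_neq0 hPhi ha).
have hD' : (dot x a - k%:~R) ^+ 2 <= D * dot a a.
  by move: hD; rewrite /wall_dist2 /aval /= ler_pdivrMr.
have D0 : 0 <= D.
  by apply: le_trans hD; rewrite divr_ge0 ?sqr_ge0 ?ltW.
have hB : `|dot x a| + 1 + D * dot a a <= B.
  rewrite /B (big_fsetD1 _ ha) /= lerDl; apply: sumr_ge0 => b _.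
  by rewrite !addr_ge0 // mulr_ge0 // dot_ge0.
have hk : `|k%:~R : R| <= B.
  apply: le_trans hB; set e := dot x a in hD' *.
  have h1 : `|e - k%:~R| <= 1 + D * dot a a.
    case: (lerP `|e - k%:~R| 1) => h; first by rewrite ler_wpDr // mulr_ge0 // ltW.
    apply: le_trans (_ : `|e - k%:~R| ^+ 2 <= _); first by rewrite ler_eXnr // ltW.
    by rewrite real_normK ?num_real // ler_wpDl.
  have -> : k%:~R = e - (e - k%:~R) :> R by ring.
  by apply: le_trans (ler_normB _ _) _; rewrite -addrA lerD2l.
have hM : (absz k <= M)%N.
  have : `|k%:~R : R| < M%:R.
    apply: le_lt_trans hk _; apply: le_lt_trans (ler_norm _) _.
    exact: archi_boundP.
  by rewrite -intr_norm -natr_absz ltr_nat => /ltnW.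
by apply/mapP; exists (absz (k + M%:Z)); rewrite ?mem_iota; lia.
Qed.

(** Take for [ga] the pullback of [al] by [arefl be]. Its root is as long as [al.1], and its value
    at [x] is [A - 2 * t] with [t = s * B / q] in the notation of the proof; Cauchy-Schwarz and the
    closeness of [be] give [0 < t < A]. *)
Lemma closer_conjugate al be : al.1 \in Phi -> be.1 \in Phi ->
  0 < aval al x -> 0 < aval be x -> 0 < dot al.1 be.1 ->
  wall_dist2 be < wall_dist2 al ->
  exists ga, [/\ ga.1 \in Phi, wall_dist2 ga < wall_dist2 al &
    arefl al = arefl be \o arefl ga \o arefl be].
Proof.
move=> ha hb A0 B0 s0 hlt; have [ga [e v c]] := arefl_pullback ha hb.
have p0 := dot_gt0 (roots_neq0 hPhi ha); have q0 := dot_gt0 (roots_neq0 hPhi hb).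
exists ga; split; first by rewrite e; apply: (roots_stable hPhi).
  rewrite /wall_dist2 v aval_arefl e reflection_dot ?(roots_neq0 hPhi) //.
  rewrite ltr_pM2r ?invr_gt0 // dot_coroot.
  move: hlt; rewrite /wall_dist2 ltr_pdivrMr // mulrAC ltr_pdivlMr //.
  set A := aval al x in A0 *; set B := aval be x in B0 *.
  set p := dot al.1 _ in p0 *; set q := dot be.1 _ in q0 *.
  set s := dot al.1 _ in s0 * => hlt.
  have CS : s ^+ 2 <= p * q.
    have := dot_ge0 (q *: al.1 - s *: be.1).
    rewrite !dotE (dotC be.1) -/s -/q -/p.
    rewrite [X in 0 <= X](_ : _ = q * (p * q - s ^+ 2)); last by ring.
    by rewrite pmulr_rge0 // subr_ge0.
  have sB : s * B < A * q.
    rewrite -ltr_sqr ?nnegrE ?mulr_ge0 ?ltW // !exprMn.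
    apply: (@le_lt_trans _ _ (p * q * B ^+ 2)); first by rewrite ler_wpM2r ?sqr_ge0.
    by rewrite mulrAC [X in _ < X](_ : _ = A ^+ 2 * q * q) ?ltr_pM2r // -?mulrA //; nra.
  have -> : A - B * (2 * s / q) = A - 2 * (s * B / q) by field; rewrite gt_eqF.
  have t1 : s * B / q < A by rewrite ltr_pdivrMr.
  have t0 : 0 < s * B / q by rewrite divr_gt0 // mulr_gt0.
  move: (s * B / q) t0 t1 => t t0 t1.
  by rewrite -subr_gt0 (_ : _ - _ = 4 * (t * (A - t))) ?mulr_gt0 ?subr_gt0 //; ring.
by rewrite c; apply/funext => y /=; rewrite arefl_invol.
Qed.

(* The walls of [be] and of its mirror image [- (be \o r_al)] are candidates for
   [de]: both affine functions are positive at [x] and they add up to a multiple of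
   [al], so by Cauchy-Schwarz they cannot both be as far from [x] as [al]. *)
Lemma closer_separating al be : al.1 \in Phi -> be.1 \in Phi ->
  0 < aval al x -> 0 < aval be x -> aval be (arefl al x) < 0 ->
  arefl be <> arefl al ->
  exists2 de, [/\ de.1 \in Phi, 0 < aval de x & 0 < dot al.1 de.1] &
    wall_dist2 de < wall_dist2 al.
Proof.
move=> ha hb A0 B0; rewrite aval_arefl dot_coroot => hB' hne.
have p0 := dot_gt0 (roots_neq0 hPhi ha); have q0 := dot_gt0 (roots_neq0 hPhi hb).
have s0 : 0 < dot al.1 be.1.
  rewrite ltNge; apply/negP => s0; move: hB'; apply/negP; rewrite -leNgt.
  rewrite subr_ge0 (le_trans _ (ltW B0)) // (dotC be.1).
  by rewrite pmulr_rle0 // pmulr_lle0 ?invr_gt0 // pmulr_rle0.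
case: (ltP (wall_dist2 be) (wall_dist2 al)) => h1; first by exists be.
have [ga [e v c]] := arefl_pullback hb ha.
have hg : ga.1 \in Phi by rewrite e; apply: (roots_stable hPhi).
have vg : aval (aopp ga) x = aval al x * (2 * dot be.1 al.1 / dot al.1 al.1) - aval be x.
  by rewrite aval_opp v aval_arefl dot_coroot opprB.
have sg : dot al.1 (aopp ga).1 = dot al.1 be.1.
  rewrite /= dotNr e -dot_reflectionC reflection_self ?(roots_neq0 hPhi) //.
  by rewrite dotNl opprK.
have G0 : 0 < aval (aopp ga) x by rewrite vg subr_gt0 -subr_lt0.
have qg : dot ga.1 ga.1 = dot be.1 be.1 by rewrite e reflection_dot // (roots_neq0 hPhi).
case: (ltP (wall_dist2 (aopp ga)) (wall_dist2 al)) => h2.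
  by exists (aopp ga) => //; split; rewrite ?sg // roots_opp.
(* Both candidates are now at least as far from [x] as [al]. This forces equality in Cauchy-Schwarz,
   so [be.1] is a multiple of [al.1], and reducedness with [0 < s] makes them equal. Then
   [C = 2 * A - B], and [A <= B], [A <= C] leave only [A = B]: the same wall. *)
exfalso; apply: hne.
move: h1 h2; rewrite wall_dist2_opp /wall_dist2 qg -(sqrrN (aval ga x)) -aval_opp.
rewrite !ler_pdivlMr // !(mulrAC _ _ (dot be.1 be.1)) !ler_pdivrMr //.
move: G0 vg; rewrite (dotC be.1 al.1).
have CS := @dot_CS_collinear _ _ al.1 be.1.
set C := aval (aopp ga) x; set A := aval al x in A0 *; set B := aval be x in B0 *.
set p := dot al.1 _ in p0 CS *; set q := dot be.1 _ in q0 CS *.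
set s := dot al.1 _ in s0 CS * => G0 vg.
rewrite !(mulrAC A q) -!expr2 => h1 h2.
have ABC : A ^+ 2 * q <= B * C * p.
  have C0 : 0 <= B * C * p by rewrite !mulr_ge0 ?(ltW B0) ?(ltW G0) ?(ltW p0).
  have A20 : 0 <= A ^+ 2 * q by rewrite pmulr_lge0 ?sqr_ge0.
  rewrite -ler_sqr ?nnegrE //.
  rewrite expr2 [leRHS](_ : _ = (B ^+ 2 * p) * (C ^+ 2 * p)); last by ring.
  by apply: ler_pM.
have sA : (B + C) * p = 2 * s * A by rewrite vg; field; rewrite gt_eqF.
have pq : p * q <= s ^+ 2.
  have A2 : 0 < 4 * A ^+ 2 by rewrite mulr_gt0 // exprn_gt0.
  rewrite -(ler_pM2l A2) [leRHS](_ : _ = ((B + C) * p) ^+ 2); last by rewrite sA; ring.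
  rewrite [leLHS](_ : _ = p * (A ^+ 2 * q + A ^+ 2 * q + 2 * (A ^+ 2 * q))); last by ring.
  rewrite [leRHS](_ : _ = p * (B ^+ 2 * p + C ^+ 2 * p + 2 * (B * C * p))); last by ring.
  by rewrite ler_pM2l //; lra.
have be_al : be.1 = (s / p) *: al.1.
  by rewrite mulrC -scalerA -CS // scalerA mulVf ?scale1r // gt_eqF.
have sp : s / p = 1.
  have [//|sp] := roots_reduced hPhi ha (eq_ind _ (fun a => a \in Phi) hb _ be_al).
  by have := divr_gt0 s0 p0; rewrite sp oppr_gt0 ltr10.
have {}be_al : be.1 = al.1 by rewrite be_al sp scale1r.
have {}sp : s = p by rewrite /s be_al.
have qp : q = p by rewrite /q be_al.
move: h1 h2; rewrite qp !ler_pM2r // !ler_sqr ?nnegrE ?(ltW A0) ?(ltW B0) ?(ltW G0) //.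
rewrite vg sp mulfK ?gt_eqF // => h1 h2.
have AB : A = B by lra.
move: AB; rewrite /A /B /aval be_al => /addrI/oppr_inj/intr_inj k.
by rewrite /arefl be_al k.
Qed.

(** Passing to the opposite affine root changes neither the reflection nor the distance, so both
    [al] and [be] can be taken positive at [x]. *)
Lemma separating_wall_reduction al be : al.1 \in Phi -> be.1 \in Phi ->
  aval be x * aval be (arefl al x) < 0 -> arefl be <> arefl al ->
  exists de ga, [/\ de.1 \in Phi /\ ga.1 \in Phi, wall_dist2 de < wall_dist2 al,
    wall_dist2 ga < wall_dist2 al & arefl al = arefl de \o arefl ga \o arefl de].
Proof.
move=> ha; wlog A0 : al ha / 0 < aval al x => [IH|].
  have [|] := ltrP 0 (aval al x); first exact: IH.
  rewrite le_eqVlt (negPf (x_regular ha)) /= => A0.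
  have := IH (aopp al); rewrite arefl_opp wall_dist2_opp; apply.
    exact: roots_opp.
  by rewrite aval_opp oppr_gt0.
wlog B0 : be / 0 < aval be x => [IH hb|hb].
  have [|] := ltrP 0 (aval be x); first by move/IH; apply.
  rewrite le_eqVlt (negPf (x_regular hb)) /= => B0.
  have := IH (aopp be); rewrite arefl_opp !aval_opp mulrNN; apply.
    by rewrite oppr_gt0.
  exact: roots_opp.
rewrite pmulr_rlt0 // => sep ne.
have [de [hd D0 s0] hlt] := closer_separating ha hb A0 B0 sep ne.
have [ga [hg glt e]] := closer_conjugate ha hd A0 D0 s0 hlt.
by exists de, ga.
Qed.

(** Real distances are not well-founded. The induction is on the number of entries of [L] strictly
    closer than the current wall, where [L] contains everything no farther than the initial one. *)
Lemma wall_dist2_ind (P : aroot -> Prop) :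
  (forall al, al.1 \in Phi ->
     (forall be, be.1 \in Phi -> wall_dist2 be < wall_dist2 al -> P be) -> P al) ->
  forall al, al.1 \in Phi -> P al.
Proof.
move=> step al ha; have [L hL] := finitely_many_close_walls (wall_dist2 al).
pose closer be := [pred c | wall_dist2 c < wall_dist2 be].
suff main n be : be.1 \in Phi -> wall_dist2 be <= wall_dist2 al ->
    (count (closer be) L < n)%N -> P be by apply: (main _ al ha _ (ltnSn _)).
elim: n be => [//|n IH] be hb hle hn; apply: step => // ga hg glt.
have gle := le_trans (ltW glt) hle; apply: IH => //.
move: hn; rewrite ltnS; apply: leq_trans; apply: (@ltn_count _ _ _ L ga) => //=.
- by move=> c /= /lt_trans; apply.
- exact: hL.
- by rewrite ltxx.
Qed.

Lemma arefl_simple_word al : al.1 \in Phi ->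
  exists2 s, (forall be, be \in s -> simple_at be) & arefl al = word s.
Proof.
move: al; apply: wall_dist2_ind => al ha IH.
have [hs|] := pselect (simple_at al).
  by exists [:: al] => // be; rewrite inE => /eqP ->.
move=> /not_andP[//|] /existsNP[be] /not_implyP[hb] /not_implyP[sep ne].
have [de [ga [[hd hg] dlt glt e]]] := separating_wall_reduction ha hb sep ne.
have [sd hsd ed] := IH de hd dlt; have [sg hsg eg] := IH ga hg glt.
exists (sd ++ sg ++ sd); last by rewrite !word_cat -ed -eg.
by move=> c; rewrite !mem_cat => /or3P[/hsd|/hsg|/hsd].
Qed.

Lemma word_simple s : {in s, forall be, be.1 \in Phi} ->
  exists2 t, (forall be, be \in t -> simple_at be) & word s = word t.
Proof.
elim: s => [|al s IH] hs; first by exists [::].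
have [t1 h1 e1] := arefl_simple_word (hs al (mem_head _ _)).
have [|t2 h2 e2] := IH; first by move=> c hc; apply: hs; rewrite inE hc orbT.
exists (t1 ++ t2); last by rewrite word_cat -e1 -e2.
by move=> c; rewrite mem_cat => /orP[/h1|/h2].
Qed.

(** The images of [x] under growing prefixes of [s] lead across the wall of [al] without ever lying
    on it, so two consecutive ones are on different sides. *)
Lemma word_crossing al s : al.1 \in Phi -> {in s, forall be, be.1 \in Phi} ->
  aval al x * aval al (word s x) < 0 ->
  exists s1 be s2, s = s1 ++ be :: s2 /\
    aval al (word s1 x) * aval al (word s1 (arefl be x)) < 0.
Proof.
move=> ha; elim/last_ind: s => [|s be IH] hs; first by rewrite -expr2 ltNge sqr_ge0.
rewrite -cats1 word_cat /= => hlast.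
have hs' : {in s, forall c, c.1 \in Phi}.
  by move=> c hc; apply: hs; rewrite mem_rcons inE hc orbT.
have [/(IH hs')[s1 [c [s2 [-> hc]]]]|h] := ltP (aval al x * aval al (word s x)) 0.
  by exists s1, c, (rcons s2 be); rewrite cats1 rcons_cat.
exists s, be, [::]; split=> //; have := x_regular ha; have := word_regular hs' ha.
move: hlast h; move: (aval al x) (aval al _) (aval al _) => a b c.
by move=> *; nra.
Qed.

(** Pulled back through the prefix [s1], the wall of [al] separates [x] from its image under the
    crossing letter [be]. Simplicity identifies the two reflections, so [arefl al] moves through
    [s1] as [arefl be] and cancels that letter. *)
Lemma simple_word_deletion al s : al.1 \in Phi ->
  (forall be, be \in s -> simple_at be) -> aval al x * aval al (word s x) < 0 ->
  exists2 t, {subset t <= s} /\ (size t < size s)%N & arefl al \o word s = word t.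
Proof.
move=> ha hs; have hs' : {in s, forall be, be.1 \in Phi} by move=> be /hs[].
move=> /(word_crossing ha hs')[s1 [be [s2 [es hc]]]].
have hs1 : {in s1, forall be, be.1 \in Phi}.
  by move=> c hcs; apply: hs'; rewrite es mem_cat hcs.
have [hb hsimple] : simple_at be by apply: hs; rewrite es mem_cat mem_head orbT.
have [ga [hg v c]] := word_pullback hs1 ha.
have ega : arefl ga = arefl be by apply: hsimple; rewrite ?v.
exists (s1 ++ s2).
  split; first by move=> e; rewrite es !mem_cat inE => /orP[]->; rewrite ?orbT.
  by rewrite es !size_cat /= addnS ltnS.
rewrite es !word_cat /= compA -c ega; apply/funext => y /=.
by rewrite arefl_invol.
Qed.

Lemma word_chamber_fix s : {in s, forall be, be.1 \in Phi} ->
  (forall be, be.1 \in Phi -> 0 < aval be x * aval be (word s x)) -> word s = id.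
Proof.
move=> /word_simple[t ht ->].
have [n] := ubnP (size t); elim: n t ht => [//|n IH] [//|al t] ht /= hn hx.
have [ha _] : simple_at al by apply: ht; rewrite mem_head.
have [||r [rt rs] e] := @simple_word_deletion al t ha.
- by move=> c hc; apply: ht; rewrite inE hc orbT.
(* Reflecting in the wall of [al] swaps its sides and brings [word t x] to the side of [x], so
   [word t x] itself is on the other side. *)
- have := hx al ha; rewrite aval_arefl dot_coroot mulfK; last first.
    by rewrite gt_eqF // dot_gt0 ?(roots_neq0 hPhi).
  by move=> h; rewrite -oppr_gt0; lra.
rewrite e; apply: IH => //.
- by move=> c /rt hc; apply: ht; rewrite inE hc orbT.
- by move: rs hn; lia.
- by move=> be hb; rewrite -e; exact: hx.
Qed.
End BasePoint.
End AffineRoots.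

(** * The affine Weyl group acts freely on alcoves *)

Section AffineWeyl.
Variables (R : realType) (d : nat).
Notation V := 'rV[R]_d.
Variables Phi Pos : {fset V}.
Hypothesis hPhi : crystallographic_root_system Phi.
Hypothesis hPos : is_positive_roots Phi Pos.

Lemma pos_root a : a \in Pos -> a \in Phi.
Proof. by have [rho [_ ->]] := hPos; rewrite !inE => /andP[]. Qed.

Lemma pos_or_opp a : a \in Phi -> a \in Pos \/ - a \in Pos.
Proof.
have [rho [reg ->]] := hPos => ha; have := reg a ha; rewrite neq_lt => /orP[] h.
  by right; rewrite !inE /= (roots_opp hPhi ha) dotNr oppr_gt0.
by left; rewrite !inE /= ha.
Qed.

Lemma pos_collinear a b c : a \in Pos -> b \in Pos -> b = c *: a -> b = a.
Proof.
move=> ha hb e; have hbP := pos_root hb; rewrite e in hbP.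
have [c1|c1] := roots_reduced hPhi (pos_root ha) hbP; first by rewrite e c1 scale1r.
have [rho [_ eP]] := hPos; move: ha hb; rewrite eP !inE e c1 scaleN1r dotNr oppr_gt0.
by move=> /andP[_ /lt_trans h] /andP[_ /h]; rewrite ltxx.
Qed.

Lemma weyl_word u : weyl Phi u ->
  exists2 s, {in s, forall be : V * int, be.1 \in Phi} & u = word s.
Proof.
elim=> [|a {}u ha _ [s hs ->]]; first by exists [::].
exists ((a, 0) :: s) => // c; rewrite inE => /predU1P[->//|]; exact: hs.
Qed.

(** Translation by [coroot a *~ n] is the product of the reflections in the parallel walls
    [wall a n] and [wall a 0]. *)
Lemma transl_word mu : coroot_lattice Phi mu ->
  exists2 s, {in s, forall be : V * int, be.1 \in Phi} & forall y, word s y = y + mu.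
Proof.
move=> [n ->]; have : {subset (Phi : seq V) <= Phi} by [].
elim: (Phi : seq V) => [|a r IH] hr.
  by exists [::] => // y; rewrite big_nil addr0.
have [|s hs es] := IH; first by move=> b hb; apply: hr; rewrite inE hb orbT.
have ha : a \in Phi by apply: hr; rewrite mem_head.
exists [:: (a, n a), (a, 0) & s].
  by move=> c; rewrite !inE => /or3P[/eqP->|/eqP->|/hs].
move=> y; rewrite big_cons [RHS]addrCA addrC -es /= /arefl /=.
move: (word s y) => z; rewrite -/(reflection a z) {1}/areflection.
rewrite dot_reflectionC reflection_self ?(roots_neq0 hPhi) // dotNr reflectionE.
rewrite -addrA -opprD -scalerDl addrA subrr sub0r scaleNr opprK.
by rewrite scaler_int.
Qed.

Lemma affine_weyl_word z : affine_weyl Phi z ->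
  exists2 s, {in s, forall be : V * int, be.1 \in Phi} & aff_act z = word s.
Proof.
move=> [/transl_word[s hs es] /weyl_word[t ht et]]; exists (s ++ t).
  by move=> c; rewrite mem_cat => /orP[/hs|/ht].
by apply/funext => y; rewrite word_cat /= es /aff_act et.
Qed.

Lemma weyl0 u : weyl Phi u -> u 0 = 0.
Proof.
by elim=> [//|a {}u _ _ IH] /=; rewrite IH reflectionE dot0l scale0r subr0.
Qed.

Lemma fund_alcove_interior : exists x, forall a, a \in Pos -> 0 < dot x a < 1.
Proof.
have [rho [_ eP]] := hPos.
have rho_pos a : a \in Pos -> 0 < dot rho a by rewrite eP !inE => /andP[].
(* [S] exceeds the value of every positive root at [rho], so dividing [rho] by it brings these
   values below 1. *)
pose S := 1 + \sum_(a <- Pos) dot rho a.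
have S_gt a : a \in Pos -> dot rho a < S.
  move=> ha; rewrite /S (big_fsetD1 _ ha) /= addrCA ltrDl ltr_wpDr //.
  by rewrite big_seq; apply: sumr_ge0 => b; rewrite !inE => /andP[_ /rho_pos/ltW].
have S0 : 0 < S.
  by rewrite /S ltr_wpDr // big_seq; apply: sumr_ge0 => b /rho_pos/ltW.
exists (S^-1 *: rho) => a ha; rewrite dotZl mulr_gt0 ?invr_gt0 ?rho_pos //=.
by rewrite mulrC ltr_pdivrMr // mul1r S_gt.
Qed.

(** No integer lies strictly between 0 and 1, so no wall meets the interior of the fundamental
    alcove. The point [c] may be on its boundary, hence the condition on [aval be c]. *)
Lemma fund_alcove_same_side x c (be : V * int) : be.1 \in Phi ->
  (forall a, a \in Pos -> 0 < dot x a < 1) -> fund_alcove Pos c -> aval be c != 0 ->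
  0 < aval be x * aval be c.
Proof.
wlog hb : be / be.1 \in Pos => [IH ha hx hc nz|_ hx hc].
  have [hb|hb] := pos_or_opp ha; first exact: IH.
  rewrite -mulrNN -!aval_opp; apply: IH => //; first exact: pos_root.
  by rewrite aval_opp oppr_eq0.
have /andP[x0 x1] := hx _ hb; have [c0 c1] := hc _ hb.
rewrite /aval; case: (lerP be.2 0) => k nz.
  have k0 : be.2%:~R <= 0 :> R by rewrite lerz0.
  rewrite mulr_gt0 //; first by lra.
  by rewrite lt_def nz; lra.
have k1 : 1 <= be.2%:~R :> R by rewrite ler1z.
rewrite nmulr_rgt0; last by lra.
by rewrite lt_def eq_sym nz; lra.
Qed.

Lemma fund_alcove_regular x : (forall a, a \in Pos -> 0 < dot x a < 1) ->
  forall be : V * int, be.1 \in Phi -> aval be x != 0.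
Proof.
move=> hx be; wlog hb : be / be.1 \in Pos => [IH ha|_].
  have [hb|hb] := pos_or_opp ha; first exact: IH.
  by have := IH (aopp be); rewrite aval_opp oppr_eq0; apply=> //; exact: pos_root.
have /andP[x0 x1] := hx _ hb; rewrite /aval subr_eq0; apply/eqP => e.
by move: x0 x1; rewrite e ltr0z ltrz1; lia.
Qed.

Lemma alcove_zeta_inj y z : affine_weyl Phi y -> affine_weyl Phi z ->
  aff_act y @` fund_alcove Pos = aff_act z @` fund_alcove Pos -> zeta y = zeta z.
Proof.
move=> hy hz eyz; have [x hx] := fund_alcove_interior.
have x_reg := fund_alcove_regular hx.
have [s hs es] := affine_weyl_word hy; have [t ht et] := affine_weyl_word hz.
have ht' : {in rev t, forall be, be.1 \in Phi} by move=> c; rewrite mem_rev => /ht.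
have xC : fund_alcove Pos x by move=> a /hx/andP[/ltW ? /ltW ?]; split.
have [c cC ec] : (aff_act z @` fund_alcove Pos) (aff_act y x) by rewrite -eyz; exists x.
have hw : {in rev t ++ s, forall be, be.1 \in Phi}.
  by move=> e; rewrite mem_cat => /orP[/ht'|/hs].
have wx : word (rev t ++ s) x = c.
  by rewrite word_cat /= -es -ec et (word_rev_cancel hPhi).
(* This word is the inverse of [z] times [y]. It sends [x] to a point [c] of the same closed alcove,
   and [c] is on no wall because it is an image of [x]. *)
have w1 : word (rev t ++ s) = id.
  apply: (word_chamber_fix hPhi x_reg hw) => be hb.
  rewrite wx; apply: fund_alcove_same_side => //.
  by rewrite -wx; exact: (word_regular hPhi x_reg hw hb).
have {es et} eact p : aff_act y p = aff_act z p.
  rewrite es et -{2}[p]/(id p) -w1 word_cat /= -{1}[t]revK.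
  by rewrite (word_rev_cancel hPhi ht').
have [_ /weyl0 y0] := hy; have [_ /weyl0 z0] := hz.
have et : transl y = transl z by have := eact 0; rewrite /aff_act y0 z0 !add0r.
by apply/funext => p; have := eact p; rewrite /aff_act et => /addIr.
Qed.

(** * Left multiplication by affine reflections *)

Lemma coroot_lattice_dot mu a : a \in Phi -> coroot_lattice Phi mu ->
  exists m : int, dot mu a = m%:~R.
Proof.
move=> ha [n ->]; rewrite dot_suml.
have : {subset (Phi : seq V) <= Phi} by [].
elim: (Phi : seq V) => [|b r IH] hr; first by exists 0; rewrite big_nil.
have [|m hm] := IH; first by move=> c hc; apply: hr; rewrite inE hc orbT.
have [|k hk] := roots_integral hPhi (_ : b \in Phi) ha; first by rewrite hr ?mem_head.
exists (k * n b + m); rewrite big_cons hm -scaler_int dotZl (dotC _ a) hk.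
by rewrite rmorphD rmorphM mulrC.
Qed.

Lemma coroot_latticeD mu a (m : int) : a \in Phi -> coroot_lattice Phi mu ->
  coroot_lattice Phi (mu + coroot a *~ m).
Proof.
move=> ha [n ->]; exists (fun b => n b + if b == a then m else 0).
transitivity (\sum_(b <- Phi) (coroot b *~ n b + coroot b *~ (if b == a then m else 0))).
  rewrite big_split /=; congr (_ + _); rewrite (big_fsetD1 _ ha) /= eqxx big_seq big1.
    by rewrite addr0.
  by move=> b; rewrite !inE => /andP[/negPf-> _].
by apply: eq_bigr => b _; rewrite mulrzDr.
Qed.

(** The reflection changes [transl z] by an integer multiple of [coroot a], and its linear part
    multiplies the spherical direction on the left. *)
Lemma areflection_affine_weyl a (k : int) z : a \in Phi -> affine_weyl Phi z ->
  exists z', [/\ affine_weyl Phi z', aff_act z' = areflection a k \o aff_act z &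
    zeta z' = reflection a \o zeta z].
Proof.
move=> ha [hl hu].
exists (AffElt (areflection a k (transl z)) (reflection a \o zeta z)); split => //.
  split; last exact: weyl_refl.
  have [m hm] := coroot_lattice_dot ha hl.
  rewrite /= /areflection hm -intrB scaler_int -mulrNz.
  exact: coroot_latticeD.
by apply/funext => y; rewrite /aff_act /= areflection_affine.
Qed.
End AffineWeyl.

(** * Panels and foldings *)

Section Panels.
Variables (R : realType) (d : nat).
Notation V := 'rV[R]_d.
Implicit Types p : set V.

(* The only consequence of codimension one that is needed; unlike [affine_dim],
   it is immediately seen to be preserved by reflections. *)
Definition determines_normal p : Prop := forall (a b : V) (k m : R), a != 0 ->
  (forall y, p y -> dot y a = k) -> (forall y, p y -> dot y b = m) ->
  exists c, b = c *: a.

(** Differences of points of [p] are orthogonal to [a] and [b] and span dimension [d - 1]. Were [a]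
    and [b] independent, adding their span would give dimension [d + 1]. *)
Lemma affine_dim_determines_normal p k :
  affine_dim p k -> k.+1 = d -> determines_normal p.
Proof.
move=> [x [s []]]; set U := (<<_>>)%VS => px hs _ dimU kd a b ka kb a0 ha hb.
have orth v e l : v \in U -> (forall y, p y -> dot y e = l) -> dot v e = 0.
  move=> /(@coord_span _ _ _ (in_tuple _)) -> he; rewrite dot_suml big1 // => i _.
  rewrite dotZl; have : (in_tuple [seq y - x | y <- s])`_i \in [seq y - x | y <- s].
    by rewrite mem_nth.
  by move=> /mapP[y /hs py ->]; rewrite dotBl !he // subrr mulr0.
have [/vlineP//|nab] := boolP (b \in <[a]>%VS).
have fr : free [:: b; a] by rewrite free_cons span_seq1 nab seq1_free.
have disj : (U :&: <<[:: b; a]>> = 0)%VS.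
  apply/eqP; rewrite -subv0; apply/subvP => v; rewrite memv_cap => /andP[vU].
  rewrite span_cons span_seq1 => /memv_addP[_ /vlineP[c1 ->] [_ /vlineP[c2 ->] ev]].
  rewrite memv0 -dot_eq0 {2}ev dotDr !dotZr.
  by rewrite (orth _ _ _ vU ha) (orth _ _ _ vU hb) !mulr0 addr0.
have := dimvS (subvf (U + <<[:: b; a]>>)).
rewrite dimv_disjoint_sum // dimU (eqP fr) dimvf dim_matrix mul1r /=.
by lia.
Qed.

Lemma determines_normal_areflection p a (k : int) : a != 0 ->
  determines_normal p -> determines_normal (areflection a k @` p).
Proof.
move=> a0 hp b c l m b0 hb hc.
have pull (e : V) (n : R) : (forall y, (areflection a k @` p) y -> dot y e = n) ->
    forall y, p y -> dot y (reflection a e) = n - k%:~R * dot (coroot a) e.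
  move=> he y py; rewrite -dot_reflectionC.
  have := he (areflection a k y) (ex_intro2 _ _ y py erefl).
  by rewrite /areflection reflectionE !dotBl !dotZl; lra.
have [|e he] := hp _ _ _ _ _ (pull _ _ hb) (pull _ _ hc).
  by rewrite -dot_eq0 reflection_dot // dot_eq0.
exists e; apply: (can_inj (areflection_invol 0 a0)).
by rewrite -!/(reflection a _) he reflectionZ.
Qed.
End Panels.

(** * Reflecting the tail of a gallery *)

Section MapTail.
Variables (V : Type) (r : V -> V).
Implicit Types (g : gallery V) (i j : nat).

Lemma size_panels_map_tail i g : size (panels (map_tail r i g)) = size (panels g).
Proof. by rewrite size_cat size_map -size_cat cat_take_drop. Qed.

Lemma size_alcoves_map_tail i g : size (alcoves (map_tail r i g)) = size (alcoves g).
Proof. by rewrite size_cat size_map -size_cat cat_take_drop. Qed.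

Lemma panel_at_map_tail_le i j g : panel_index g i -> (j <= i)%N ->
  panel_at (map_tail r i g) j = panel_at g j.
Proof.
move=> /andP[i0 ig] ji; rewrite /panel_at /= nth_cat size_takel //.
(* Panels are numbered from 1, so panel [i] sits at position [i.-1], among the first [i] entries,
   which are kept. *)
have ji' : (j.-1 < i)%N by lia.
by rewrite ji' nth_take.
Qed.

Lemma panel_at_map_tail_gt i j g : panel_index g j -> (i < j)%N ->
  panel_at (map_tail r i g) j = r @` panel_at g j.
Proof.
move=> /andP[j0 jg] ij; rewrite /panel_at /= nth_cat size_takel; last by lia.
have -> : (j.-1 < i)%N = false by lia.
rewrite (nth_map set0) ?size_drop; last by lia.
by rewrite nth_drop subnKC //; lia.
Qed.

Lemma end_alcove_map_tail i g : size (alcoves g) = (size (panels g)).+1 ->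
  panel_index g i -> end_alcove (map_tail r i g) = r @` end_alcove g.
Proof.
move=> sg /andP[i0 ig]; rewrite /end_alcove size_panels_map_tail /alcove_at /= nth_cat.
rewrite size_takel; last by lia.
have -> : (size (panels g) < i)%N = false by lia.
rewrite (nth_map set0) ?size_drop; last by lia.
by rewrite nth_drop subnKC.
Qed.
End MapTail.

(** * Spherical directions along a sequence of folds *)

Section Foldings.
Variables (R : realType) (d : nat).
Notation V := 'rV[R]_d.
Variables Phi Pos : {fset V}.
Hypothesis hPhi : crystallographic_root_system Phi.
Hypothesis hPos : is_positive_roots Phi Pos.

Lemma wall_of_class p a b k m : determines_normal p ->
  wall_of Pos p a k -> wall_of Pos p b m -> b = a.
Proof.
move=> hp [ha pa] [hb pb].
have [c] := hp a b _ _ (roots_neq0 hPhi (pos_root hPos ha)) pa pb.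
exact: (pos_collinear hPhi hPos ha hb).
Qed.

Lemma foldings_panel_before g g' I i : foldings Pos g I g' ->
  {in I, forall j, i <= j}%N -> panel_at g' i = panel_at g i.
Proof.
elim: I g => [|j I IH] g /=; first by move=> ->.
move=> [g1 [[hj [a [k [_ e]]]] hf]] hI.
rewrite (IH g1 hf) => [|l hl]; last by apply: hI; rewrite inE hl orbT.
by rewrite e panel_at_map_tail_le // hI ?mem_head.
Qed.

Lemma moment_edge_target a u u' : moment_edge Phi Pos a u u' -> u' = reflection a \o u.
Proof.
move=> [x [_ ha [[-> //]|[-> ->]]]]; apply/funext => y /=.
by rewrite /reflection areflection_invol // (roots_neq0 hPhi (pos_root hPos ha)).
Qed.

(** The start gallery varies in the induction. In place of [is_gallery] it carries only the sizes
    and the normals of panels, which visibly survive reflecting a tail. *)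
Lemma foldings_zeta I : forall alphas g g' v us z,
  size (alcoves g) = (size (panels g)).+1 ->
  (forall i, panel_index g i -> determines_normal (panel_at g i)) ->
  folded_by_at Pos alphas I g g' -> moment_path Phi Pos v alphas us ->
  affine_weyl Phi z -> zeta z = v -> end_alcove g = aff_act z @` fund_alcove Pos ->
  exists z', [/\ affine_weyl Phi z', end_alcove g' = aff_act z' @` fund_alcove Pos &
    zeta z' = last v us].
Proof.
elim: I => [|i I IH] [|a alphas] g g' v us z sg hp [] //=.
  by move=> _ _ -> _; case: us => // _ hz zv eg; exists z.
move=> [sI] hsort [g1 [[hi [b [k [hw e1]]]] hf]] hwall.
case: us => [//|u us] [hu hpath] hz zv eg.
have := hsort; rewrite (path_sortedE ltn_trans) => /andP[/allP iI sortI].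
(* The pattern reads its classes in the final gallery, the fold uses the wall in the current one;
   the panel is the same since later folds have larger indices. *)
have ei : panel_at g' i = panel_at g i.
  rewrite (foldings_panel_before hf); last by move=> j /iI/ltnW.
  by rewrite e1 panel_at_map_tail_le.
have [m hm] := hwall 0%N isT; rewrite /= ei in hm.
have {hm} ab : b = a by apply: (wall_of_class (hp _ hi) hm hw).
have ha : a \in Phi by rewrite -ab; apply: (pos_root hPos); have [] := hw.
have [z1 [hz1 act1 zeta1]] := areflection_affine_weyl hPhi k ha hz.
apply: (IH alphas g1 g' u us z1) => //.
- by rewrite e1 size_panels_map_tail size_alcoves_map_tail.
- move=> j; rewrite /panel_index e1 size_panels_map_tail => hj.
  have [ji|ij] := leqP j i; first by rewrite panel_at_map_tail_le //; apply: hp.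
  rewrite panel_at_map_tail_gt //; apply: determines_normal_areflection; last exact: hp.
  by rewrite ab (roots_neq0 hPhi).
- by split=> // l hl; exact: (hwall l.+1 hl).
- by rewrite zeta1 zv (moment_edge_target hu).
- by rewrite e1 end_alcove_map_tail // eg act1 image_comp ab.
Qed.
End Foldings.

Theorem theorem4p16 (R : realType) (d : nat) (Phi Pos : {fset 'rV[R]_d})
    (hPhi : crystallographic_root_system Phi)
    (hirr : irreducible_roots Phi)
    (hPos : is_positive_roots Phi Pos)
    (w : 'rV[R]_d -> 'rV[R]_d) (hw : weyl Phi w)
    (lambda : 'rV[R]_d) (hlambda : coroot_lattice Phi lambda)
    (v : 'rV[R]_d -> 'rV[R]_d) (hv : weyl Phi v)
    (g : gallery 'rV[R]_d) (hg : is_gallery Pos g)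
    (hstart : alcove_at g 0 = fund_alcove Pos)
    (hend : end_alcove g = aff_act (AffElt lambda v) @` fund_alcove Pos)
    (alphas : seq 'rV[R]_d)
    (hpat : positive_pattern_applies Pos w alphas g)
    (us : seq ('rV[R]_d -> 'rV[R]_d))
    (hpath : moment_path Phi Pos v alphas us)
    (g' : gallery 'rV[R]_d) (hg' : obtained_by_pattern Pos alphas g g')
    (z : aff_elt R d) (hz : affine_weyl Phi z)
    (hend' : end_alcove g' = aff_act z @` fund_alcove Pos) :
  last v us = zeta z.
Proof.
have [sg _ hpanels] := hg; have [I hI] := hg'.
have hz0 : affine_weyl Phi (AffElt lambda v) by [].
have hn i : panel_index g i -> determines_normal (panel_at g i).
  move=> /hpanels[[c [_ _ [k hk kd]]] _].
  exact: (affine_dim_determines_normal hk kd).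
(* Following the folds yields some [z'] with the direction reached by the path; [z] has the same
   alcove, so freeness gives it the same direction. *)
have [z' [hz' ez' <-]] := foldings_zeta hPhi hPos sg hn hI hpath hz0 erefl hend.
by apply: (alcove_zeta_inj hPhi hPos) => //; rewrite -ez'.
Qed.
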